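(* Let $\mathcal{A}_1,\dots,\mathcal{A}_k$ be affine arrangements in vector spaces $V_1,\dots,V_k$ such that each cone $\mathbf{c}\mathcal{A}_i$ is free. Then the cone $\mathbf{c}(\mathcal{A}_1\oplus\cdots\oplus\mathcal{A}_k)$ is free.
   Context: An affine arrangement $\mathcal{A}$ in $V$ is a finite set of affine hyperplanes $\{v:\alpha(v)=c\}$ ($\alpha\in V^*\setminus\{0\}$, $c$ a scalar). Its cone $\mathbf{c}\mathcal{A}$ is the central arrangement in $\mathbb{K}\times V$ (coordinates $(x_0,v)$) consisting of the hyperplanes $\{\alpha(v)-cx_0=0\}$ for each affine hyperplane $\{\alpha=c\}\in\mathcal{A}$, together with $\{x_0=0\}$. The direct sum $\mathcal{A}_1\oplus\cdots\oplus\mathcal{A}_k$ is the affine arrangement in $V_1\times\cdots\times V_k$ consisting of $V_1\times\cdots\times H\times\cdots\times V_k$ for $H\in\mathcal{A}_i$, $i=1,\dots,k$. A central arrangement is free if its module of logarithmic vector fields $D=\{\delta\in\mathrm{Der}:\delta(\alpha_H)\in\alpha_HS\ \forall H\}$ is a free module over the polynomial ring $S$. *)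

(* Defs.v *)
From HB Require Import structures.
From mathcomp Require Import all_boot all_order all_algebra.
From mathcomp Require Import mpoly.
Set Implicit Arguments. Unset Strict Implicit. Unset Printing Implicit Defensive.
Import GRing.Theory.
Local Open Scope ring_scope.

(* Coordinates of a finite-dimensional K-vector space V are indexed by a
   finType [T], i.e. V = K^T.  The polynomial ring S of K^T is
   {mpoly K[#|T|]}, the variable for coordinate [j : T] being 'X_(enum_rank j). *)

Section Arr.
Variable K : fieldType.

Definition polyring (T : finType) := {mpoly K[#|T|]}.

Definition coordX (T : finType) (j : T) : polyring T := 'X_(enum_rank j).

(* An affine hyperplane {v : alpha(v) = c}, given by the coefficient vector
   of alpha in V^* and the scalar c. *)
Definition affHyp (T : finType) := ({ffun T -> K} * K)%type.
Definition ah_form (T : finType) (H : affHyp T) : {ffun T -> K} := H.1.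
Definition ah_const (T : finType) (H : affHyp T) : K := H.2.
Definition AffHyp (T : finType) (a : {ffun T -> K}) (c : K) : affHyp T := (a, c).

(* A (central) linear hyperplane {alpha = 0} is given by its form. *)
Definition centralArr (T : finType) := seq {ffun T -> K}.
Definition affArr (T : finType) := seq (affHyp T).

Definition wf_affArr (T : finType) (A : affArr T) :=
  forall H, H \in A -> ah_form H != 0.

Definition linpoly (T : finType) (a : {ffun T -> K}) : polyring T :=
  \sum_(j : T) a j *: coordX j.

(* A derivation of S: theta = sum_j theta_j d/dx_j *)
Definition der (T : finType) := {ffun T -> polyring T}.

Definition der_apply (T : finType) (theta : der T) (f : polyring T) : polyring T :=
  \sum_(j : T) theta j * mderiv (enum_rank j) f.

Definition logder (T : finType) (A : centralArr T) (theta : der T) : Prop :=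
  forall a, a \in A -> exists g : polyring T, der_apply theta (linpoly a) = linpoly a * g.

Definition der_comb (T : finType) (m : nat) (B : 'I_m -> der T)
  (c : 'I_m -> polyring T) : der T :=
  \sum_(i < m) [ffun j => c i * B i j].

(* D(A) is a free S-module: it has a (necessarily finite) basis. *)
Definition free_arr (T : finType) (A : centralArr T) : Prop :=
  exists (m : nat) (B : 'I_m -> der T),
    [/\ forall i, logder A (B i),
        forall theta, logder A theta -> exists c, theta = der_comb B c
      & forall c, der_comb B c = 0 -> forall i, c i = 0].

(* The cone: coordinates option T, with None the new coordinate x_0.
   {alpha = c} |-> {alpha(v) - c x_0 = 0}, plus {x_0 = 0}. *)
Definition coneForm (T : finType) (H : affHyp T) : {ffun option T -> K} :=
  [ffun j => match j with None => - ah_const H | Some j' => ah_form H j' end].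

Definition x0Form (T : finType) : {ffun option T -> K} :=
  [ffun j => if j is None then 1 else 0].

Definition cone (T : finType) (A : affArr T) : centralArr (option T) :=
  x0Form T :: map (@coneForm T) A.

(* Direct sum of the family (A_i)_{i : I} of affine arrangements in K^(T i):
   the ambient space is the product K^{sum_i T i} with coordinates {i : I & T i};
   each H in A_i gives V_1 x ... x H x ... x V_k. *)
Definition liftForm (I : finType) (T : I -> finType) (i : I) (a : {ffun T i -> K})
  (p : {i : I & T i}) : K :=
  match eqVneq (tag p) i return K with
  | EqNotNeq e => a (ecast k (T k) e (tagged p))
  | NeqNotEq _ => 0
  end.

Definition liftHyp (I : finType) (T : I -> finType) (i : I) (H : affHyp (T i))
  : affHyp {i : I & T i} :=
  @AffHyp {i : I & T i} (finfun (liftForm (ah_form H))) (ah_const H).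

Definition dirsum (I : finType) (T : I -> finType) (A : forall i, affArr (T i))
  : affArr {i : I & T i} :=
  flatten [seq map (@liftHyp I T i) (A i) | i <- enum I].

End Arr.

(* Main.v *)
(** Let [D_0(cA)] be the submodule of [D(cA)] formed by the derivations that
kill [x_0].  Every [theta] in [D(cA)] has [theta(x_0)] divisible by [x_0], so
subtracting a multiple of the Euler derivation [theta_E] gives
[D(cA) = S theta_E (+) D_0(cA)].  Hence a basis of [D_0(cA)] yields one of
[D(cA)].  Conversely, if [D(cA)] is free then [D_0(cA)] is a graded direct
summand of a free module, the image of an idempotent matrix [E], and over a
polynomial ring such a summand is free: choose homogeneous elements of it whose
coordinate rows, evaluated at the origin, form a basis of the row space of
[E(0)]; they generate by graded Nakayama, and a determinant that does not vanish
at the origin makes them independent.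

Finally [D_0] of the cone of a direct sum is the direct sum of the [D_0(cA_i)]
with scalars extended to the larger polynomial ring, and bases survive the
extension because the larger ring is flat over the smaller one. *)
Require Import Defs.
From HB Require Import structures.
From mathcomp Require Import all_boot all_order all_algebra.
From mathcomp Require Import mpoly.
Set Implicit Arguments.
Unset Strict Implicit.
Unset Printing Implicit Defensive.
Import GRing.Theory.
Local Open Scope ring_scope.

Lemma big_option (R : Type) (idx : R) (op : Monoid.com_law idx) (T : finType)
    (F : option T -> R) :
  \big[op/idx]_j F j = op (F None) (\big[op/idx]_t F (Some t)).
Proof.
rewrite (bigD1 None) //=; congr (op _ _).
rewrite (reindex_omap Some id) /=; last by case.
by apply: eq_bigl => t; rewrite eqxx.
Qed.

Lemma big_tagged (R : Type) (idx : R) (op : Monoid.com_law idx) (I : finType)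
    (T : I -> finType) (F : {i : I & T i} -> R) :
  \big[op/idx]_p F p = \big[op/idx]_i \big[op/idx]_(t : T i) F (Tagged T t).
Proof. by rewrite sig_big_dep; apply: eq_bigr => -[]. Qed.

Lemma big_tagged_supp (R : Type) (idx : R) (op : Monoid.com_law idx)
    (I : finType) (T : I -> finType) (i : I) (F : {i : I & T i} -> R) :
  (forall p, tag p != i -> F p = idx) ->
  \big[op/idx]_p F p = \big[op/idx]_(t : T i) F (Tagged T t).
Proof.
move=> F_idx; rewrite big_tagged (bigD1 i) //=.
rewrite [X in op _ X]big1 ?Monoid.mulm1 // => j ne_ji.
by rewrite big1 // => t _; apply: F_idx.
Qed.

Lemma untag_Tagged (R : Type) (I : eqType) (T : I -> Type) (x0 : R) i
    (F : T i -> R) t : untag x0 F (Tagged T t) = F t.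
Proof. by rewrite (untagE (u := Tagged T t) _ _ erefl). Qed.

Section Submodules.
Variables (R : comNzRingType) (V : lmodType R).
Implicit Types (I L : finType) (D : V -> Prop).

Definition is_submod D : Prop :=
  D 0 /\ forall a u v, D u -> D v -> D (a *: u + v).

Definition spanned I (B : I -> V) (v : V) : Prop :=
  exists c : I -> R, v = \sum_i c i *: B i.

Definition lin_indep I (B : I -> V) : Prop :=
  forall c : I -> R, \sum_i c i *: B i = 0 -> forall i, c i = 0.

Definition is_basis D I (B : I -> V) : Prop :=
  [/\ forall i, D (B i), forall v, D v -> spanned B v & lin_indep B].

Lemma submodD D u v : is_submod D -> D u -> D v -> D (u + v).
Proof. by move=> [_ linD] Du Dv; rewrite -[u]scale1r; apply: linD. Qed.

Lemma submodZ D a v : is_submod D -> D v -> D (a *: v).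
Proof. by move=> [D0 linD] Dv; rewrite -[_ *: _]addr0; apply: linD. Qed.

Lemma submod_sum D (X : Type) (r : seq X) (P : pred X) (u : X -> V) :
  is_submod D -> (forall x, P x -> D (u x)) -> D (\sum_(x <- r | P x) u x).
Proof.
move=> submD Du; elim/big_ind: _ => //; first by case: submD.
by move=> v w; apply: submodD.
Qed.

Lemma spanned_submod I (B : I -> V) : is_submod (spanned B).
Proof.
split=> [|a _ _ [c ->] [d ->]].
  by exists (fun=> 0); rewrite big1 // => i _; rewrite scale0r.
exists (fun i => a * c i + d i); rewrite scaler_sumr -big_split.
by apply: eq_bigr => i _ /=; rewrite scalerA -scalerDl.
Qed.

Lemma spanned_mem I (B : I -> V) i : spanned B (B i).
Proof.
exists (fun l => (l == i)%:R); rewrite (bigD1 i) //= eqxx scale1r.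
by rewrite big1 ?addr0 // => l /negbTE->; rewrite scale0r.
Qed.

Lemma eq_is_basis D D' I (B : I -> V) :
  (forall v, D v <-> D' v) -> is_basis D B -> is_basis D' B.
Proof.
move=> eqD [DB spanB freeB]; split=> // [i|v /eqD/spanB //].
exact/eqD.
Qed.

Lemma is_basis_reindex D I L (B : I -> V) (h : L -> I) :
  bijective h -> is_basis D B -> is_basis D (B \o h).
Proof.
move=> bij_h [DB spanB freeB]; split=> [l|v /spanB[c ->]|c c_rel l].
- exact: DB.
- by exists (c \o h); rewrite (reindex h) //; apply: onW_bij.
- have [h' hK h'K] := bij_h; rewrite -[l]hK; apply: (freeB (c \o h')).
  rewrite (reindex h) /=; last exact: onW_bij.
  by under eq_bigr do rewrite hK.
Qed.

Section RowCombinations.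
Variables (m : nat) (B : 'I_m -> V).

Definition rowcomb (a : 'rV[R]_m) : V := \sum_i a 0 i *: B i.

Lemma rowcomb_is_linear : linear rowcomb.
Proof.
move=> a u v; rewrite /rowcomb scaler_sumr -big_split.
by apply: eq_bigr => i _ /=; rewrite !mxE scalerDl scalerA.
Qed.

HB.instance Definition _ :=
  GRing.isLinear.Build R 'rV[R]_m V _ rowcomb rowcomb_is_linear.

Lemma spannedP v : spanned B v <-> exists a, v = rowcomb a.
Proof.
split=> [[c ->]|[a ->]]; last by exists (a 0).
by exists (\row_i c i); apply: eq_bigr => i _; rewrite mxE.
Qed.

Lemma rowcomb_inj : lin_indep B -> injective rowcomb.
Proof.
move=> freeB a b /eqP; rewrite -subr_eq0 -raddfB => /eqP/freeB ab0.
apply/rowP => i; apply/eqP; rewrite -subr_eq0.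
by have := ab0 i; rewrite !mxE => ->.
Qed.

Lemma rowcomb_mulmx k (a : 'rV_k) (M : 'M_(k, m)) :
  rowcomb (a *m M) = \sum_i a 0 i *: rowcomb (row i M).
Proof.
rewrite mulmx_sum_row raddf_sum; apply: eq_bigr => i _ /=.
by rewrite linearZ.
Qed.

End RowCombinations.

(* Used with [E] idempotent, so that the submodule is a direct summand of the
   span of [B] when [B] is linearly independent. *)
Definition in_summand m (B : 'I_m -> V) (E : 'M_m) (v : V) : Prop :=
  exists2 a : 'rV_m, a *m E = a & v = rowcomb B a.

End Submodules.

Lemma is_basis_transfer (R : comNzRingType) (V W : lmodType R)
    (f : {linear V -> W}) (g : {linear W -> V}) (D : V -> Prop) (D' : W -> Prop)
    (I : finType) (B : I -> V) :
  (forall v, D v -> D' (f v) /\ g (f v) = v) ->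
  (forall w, D' w -> D (g w) /\ f (g w) = w) ->
  is_basis D B -> is_basis D' (f \o B).
Proof.
move=> fD gD [DB spanB freeB]; split=> [i|w /gD[/spanB[c gwE] <-]|c c_rel].
- by have [] := fD _ (DB i).
- by exists c; rewrite gwE linear_sum; apply: eq_bigr => i _; rewrite linearZ.
- apply: freeB; rewrite -[RHS](linear0 g) -c_rel linear_sum.
  by apply: eq_bigr => i _; rewrite linearZ /=; have [_ ->] := fD _ (DB i).
Qed.

Lemma is_basis_biproduct (R : comNzRingType) (I : finType) (V : lmodType R)
    (W : I -> lmodType R) (inj : forall i, {linear W i -> V})
    (proj : forall i, {linear V -> W i}) (D : forall i, W i -> Prop)
    (L : I -> finType) (B : forall i, L i -> W i) :
  (forall i w, proj i (inj i w) = w) ->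
  (forall i j w, i != j -> proj j (inj i w) = 0) ->
  (forall v, v = \sum_i inj i (proj i v)) ->
  (forall i, D i 0) -> (forall i, is_basis (@D i) (@B i)) ->
  is_basis (fun v => forall i, D i (proj i v))
    (fun q : {i : I & L i} => inj (tag q) (B (tag q) (tagged q))).
Proof.
move=> injK proj_inj0 sum_proj D0 basisB.
split=> [[i l] j /=|v Dv|c c_rel [i l]].
- have [<-|/proj_inj0->//] := eqVneq i j.
  by rewrite injK; have [] := basisB i.
- have /fin_all_exists[c c_coord] i : spanned (@B i) (proj i v).
    by have [_ spanB _] := basisB i; apply: spanB.
  exists (fun q => c (tag q) (tagged q)); rewrite big_tagged [LHS]sum_proj.
  apply: eq_bigr => i _; rewrite c_coord linear_sum.
  by apply: eq_bigr => l _; rewrite linearZ.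
- have [_ _ freeB] := basisB i; apply: (freeB (fun l => c (Tagged L l))).
  rewrite -[RHS](linear0 (proj i)) -c_rel linear_sum.
  rewrite (big_tagged_supp _ (i := i)) /= => [|q /proj_inj0 q0]; last first.
    by rewrite linearZ /= q0 scaler0.
  by apply: eq_bigr => k _; rewrite linearZ /= injK.
Qed.

(* The hypotheses make [D] the direct sum of [R * e] and the kernel of [lam]. *)
Section SplitOff.
Variables (R : idomainType) (V : lmodType R) (D : V -> Prop).
Variables (lam : {scalar V}) (e : V).
Hypotheses (D_submod : is_submod D) (De : D e) (lam_e_neq0 : lam e != 0).
Hypothesis lam_dvd : forall v, D v -> exists g, lam v = g * lam e.

Definition in_kernel (v : V) : Prop := D v /\ lam v = 0.

Lemma is_basis_split_off (I : finType) (B : I -> V) :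
  is_basis in_kernel B -> is_basis D (fun l : option I => oapp B e l).
Proof.
move=> [DB spanB freeB]; split=> [[i|] //=|v Dv|c].
- by have [] := DB i.
- have [g lam_v] := lam_dvd Dv.
  have [|c c_coord] := spanB (- g *: e + v).
    split; first exact: submodD (submodZ _ _ De) Dv.
    by rewrite linearP /= lam_v mulNr addNr.
  exists (fun l => oapp c g l); rewrite big_option /= -c_coord.
  by rewrite scaleNr addNKr.
rewrite big_option /= => c_rel.
have c_None : c None = 0.
  apply: (mulIf lam_e_neq0); have /(congr1 lam) := c_rel.
  rewrite mul0r linear0 linearD linearZ linear_sum /= big1 ?addr0 // => i _.
  by rewrite linearZ /=; have [_ ->] := DB i; rewrite mulr0.
case=> // i; apply: (freeB (c \o Some)).
by move: c_rel; rewrite c_None scale0r add0r.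
Qed.

Lemma in_kernel_summand m (B : 'I_m -> V) :
  is_basis D B ->
  exists E : 'M[R]_m, E *m E = E /\ forall v, in_kernel v <-> in_summand B E v.
Proof.
move=> [DB spanB freeB].
have /fin_all_exists[g lam_B] i := lam_dvd (DB i).
pose G : 'cV[R]_m := \col_i g i.
have lam_rowcomb (a : 'rV_m) : lam (rowcomb B a) = (a *m G) 0 0 * lam e.
  rewrite linear_sum mxE mulr_suml; apply: eq_bigr => i _.
  by rewrite linearZ /= lam_B mxE mulrA.
have /spanB/spannedP[b e_coord] := De.
have bG : b *m G = 1%:M.
  apply/rowP => i; rewrite !ord1 [RHS]mxE eqxx; apply: (mulIf lam_e_neq0).
  by rewrite -lam_rowcomb -e_coord mul1r.
have fixE (a : 'rV_m) : a *m (1%:M - G *m b) = a <-> a *m G = 0.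
  rewrite mulmxBr mulmx1 mulmxA.
  split=> [/eqP|->]; last by rewrite mul0mx subr0.
  rewrite -subr_eq0 addrAC subrr sub0r oppr_eq0 => /eqP aGb0.
  by rewrite -[LHS]mulmx1 -bG mulmxA aGb0 mul0mx.
exists (1%:M - G *m b); split.
  rewrite mulmxBr mulmx1 mulmxA mulmxBl mul1mx -[X in (G - X) *m _]mulmxA bG.
  by rewrite mulmx1 subrr mul0mx subr0.
move=> v; split=> [[/spanB/spannedP[a ->] lam_v]|[a /fixE aG0 ->]].
  exists a => //; apply/fixE/rowP => i; rewrite !ord1 [RHS]mxE.
  by apply: (mulIf lam_e_neq0); rewrite -lam_rowcomb lam_v mul0r.
split; last by rewrite lam_rowcomb aG0 mxE mul0r.
by apply: submod_sum => // i _; apply: submodZ.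
Qed.

End SplitOff.

Section Evaluation.
Variables (R : comNzRingType) (J : finType) (j : J).

Definition vec_eval (v : {ffun J -> R^o}) : R := v j.

Lemma vec_eval_is_scalar : scalar vec_eval.
Proof. by move=> a u v; rewrite /vec_eval !ffunE. Qed.

HB.instance Definition _ :=
  GRing.isLinear.Build R {ffun J -> R^o} R _ vec_eval vec_eval_is_scalar.

End Evaluation.

Section OptionVectors.
Variables (R : comNzRingType) (T : finType).
Implicit Types (u : {ffun T -> R^o}) (v : {ffun option T -> R^o}).

Definition restr_some v : {ffun T -> R^o} := [ffun t => v (Some t)].

Definition extend_none u : {ffun option T -> R^o} := [ffun j => oapp u 0 j].

Lemma restr_some_is_linear : linear restr_some.
Proof. by move=> a v w; apply/ffunP => t; rewrite !ffunE. Qed.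

Lemma extend_none_is_linear : linear extend_none.
Proof.
move=> a u w; apply/ffunP => -[t|]; rewrite !ffunE /= ?ffunE //.
by rewrite scaler0 addr0.
Qed.

HB.instance Definition _ := GRing.isLinear.Build R
  {ffun option T -> R^o} {ffun T -> R^o} _ restr_some restr_some_is_linear.
HB.instance Definition _ := GRing.isLinear.Build R
  {ffun T -> R^o} {ffun option T -> R^o} _ extend_none extend_none_is_linear.

Lemma extend_noneK : cancel extend_none restr_some.
Proof. by move=> u; apply/ffunP => t; rewrite !ffunE. Qed.

Lemma restr_someK v : v None = 0 -> extend_none (restr_some v) = v.
Proof. by move=> v0; apply/ffunP => -[t|]; rewrite !ffunE /= ?ffunE ?v0. Qed.

End OptionVectors.

Section BlockVectors.
Variables (R : comNzRingType) (I : finType) (T : I -> finType).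

Definition block_proj i (v : {ffun {i : I & T i} -> R^o}) : {ffun T i -> R^o} :=
  [ffun t => v (Tagged T t)].

Definition block_inj i (u : {ffun T i -> R^o}) : {ffun {i : I & T i} -> R^o} :=
  [ffun p => untag 0 u p].

Lemma block_proj_is_linear i : linear (@block_proj i).
Proof. by move=> a u v; apply/ffunP => t; rewrite !ffunE. Qed.

Lemma block_inj_is_linear i : linear (@block_inj i).
Proof.
move=> a u v; apply/ffunP => p; rewrite !ffunE.
have [pi|ne_pi] := eqVneq (tag p) i.
  by rewrite !(untagE _ _ pi) !ffunE.
by rewrite !untag_dflt // scaler0 addr0.
Qed.

HB.instance Definition _ i := GRing.isLinear.Build R
  {ffun {i : I & T i} -> R^o} {ffun T i -> R^o} _ (@block_proj i)
  (@block_proj_is_linear i).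
HB.instance Definition _ i := GRing.isLinear.Build R
  {ffun T i -> R^o} {ffun {i : I & T i} -> R^o} _ (@block_inj i)
  (@block_inj_is_linear i).

Lemma block_injK i : cancel (@block_inj i) (@block_proj i).
Proof. by move=> u; apply/ffunP => t; rewrite !ffunE untag_Tagged. Qed.

Lemma block_proj_inj0 i j u : i != j -> block_proj j (@block_inj i u) = 0.
Proof.
by move=> ne_ij; apply/ffunP => t; rewrite !ffunE untag_dflt // eq_sym.
Qed.

Lemma block_sum v : v = \sum_i block_inj (block_proj i v).
Proof.
apply/ffunP => -[i t]; rewrite sum_ffunE (bigD1 i) //= ffunE untag_Tagged ffunE.
by rewrite big1 ?addr0 // => j ne_ji; rewrite ffunE untag_dflt // eq_sym.
Qed.

End BlockVectors.

Lemma pihomogMl (R : nzRingType) n d e (p q : {mpoly R[n]}) :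
  p \is e.-homog ->
  pihomog mdeg d (p * q) =
    if (e <= d)%N then p * pihomog mdeg (d - e) q else 0.
Proof.
move=> homp; pose N := maxn (msize q) d.+1.
have pieceE i : pihomog mdeg d (p * pihomog mdeg i q) =
    if d == (e + i)%N then p * pihomog mdeg i q else 0.
  have hompq := dhomogM homp (pihomogP mdeg i q).
  case: eqP => [->|/eqP ne]; first by rewrite pihomog_dE.
  by rewrite (pihomog_ne0 _ hompq) // eq_sym.
rewrite {1}(pihomog_partitionE (leq_maxl _ d.+1 : _ <= N)%N).
rewrite mulr_sumr raddf_sum /=.
under eq_bigr do rewrite pieceE.
have [le_ed|lt_de] := leqP e d; last first.
  rewrite big1 // => i _; case: eqP => // d_ei.
  by rewrite d_ei ltnNge leq_addr in lt_de.
have lt_deN : (d - e < N)%N by rewrite leq_max ltnS leq_subr orbT.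
rewrite (bigD1 (Ordinal lt_deN)) //= subnKC // eqxx big1 ?addr0 // => i ne_i.
case: eqP => // d_ei; case/eqP: ne_i.
by apply: val_inj; rewrite /= d_ei addKn.
Qed.

Section GradedModules.
Variables (R : comNzRingType) (n : nat) (J : finType).
Local Notation S := {mpoly R[n]}.
Local Notation V := {ffun J -> S^o}.
Implicit Types (u v : V) (D : V -> Prop).

Definition hpart (d : nat) (v : V) : V := [ffun j => pihomog mdeg d (v j)].

Lemma hpartE d v j : hpart d v j = pihomog mdeg d (v j).
Proof. exact: ffunE. Qed.

Lemma hpart_is_zmod_morphism d : zmod_morphism (hpart d).
Proof. by move=> u v; apply/ffunP => j; rewrite !ffunE pihomogB. Qed.

HB.instance Definition _ d :=
  GRing.isZmodMorphism.Build V V (hpart d) (hpart_is_zmod_morphism d).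

Lemma hpart_hpart d e v : hpart d (hpart e v) = if d == e then hpart e v else 0.
Proof.
apply/ffunP => j; rewrite (fun_if (fun w : V => w j)) !hpartE ffunE.
case: eqP => [->|/eqP ne]; first by rewrite pihomog_id.
by rewrite (pihomog_ne0 _ (pihomogP mdeg e (v j))) // eq_sym.
Qed.

Lemma hpart_partition (I : finType) (u : I -> V) :
  exists N, forall i, u i = \sum_(d < N) hpart d (u i).
Proof.
exists (\max_i \max_j msize (u i j : S))%N => i; apply/ffunP => j.
rewrite sum_ffunE; under [RHS]eq_bigr do rewrite hpartE.
apply: pihomog_partitionE.
apply: leq_trans (leq_bigmax (F := fun i => \max_j msize (u i j : S)) i).
exact: (leq_bigmax (F := fun j => msize (u i j : S))).
Qed.

Lemma hpart_scale d (p : S) v :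
  hpart d (p *: v) =
  \sum_(m <- msupp p | (mdeg m <= d)%N)
     (p@_m *: 'X_[m] : S) *: hpart (d - mdeg m) v.
Proof.
apply/ffunP => j; rewrite sum_ffunE hpartE ffunE /= {1}[p]mpolyE.
rewrite scaler_suml raddf_sum [RHS]big_mkcond; apply: eq_bigr => m _ /=.
rewrite (pihomogMl _ _ (_ : _ \is (mdeg m).-homog)); last first.
  by rewrite rpredZ // dhomogX.
by case: ifP => // _; rewrite !ffunE.
Qed.

Definition is_graded D : Prop := forall d v, D v -> D (hpart d v).

Lemma spanned_hpart_scale (I : finType) (P : I -> V) d (p : S) v :
  (forall m, m \in msupp p -> (mdeg m <= d)%N ->
     spanned P (hpart (d - mdeg m) v)) ->
  spanned P (hpart d (p *: v)).
Proof.
move=> spanP; rewrite hpart_scale big_seq_cond.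
have submP := spanned_submod P.
apply: submod_sum => // m /andP[m_p le_md].
by apply: submodZ => //; apply: spanP.
Qed.

Lemma graded_nakayama D (I : finType) (P : I -> V) (deg : I -> nat) :
  is_graded D -> (forall i, hpart (deg i) (P i) = P i) ->
  (forall v, D v -> exists w (L : finType) (p : L -> S) (u : L -> V),
     [/\ spanned P w, forall l, D (u l), forall l, (p l)@_0%MM = 0
       & v = w + \sum_l p l *: u l]) ->
  forall v, D v -> spanned P v.
Proof.
move=> gradD homP genD.
have submP := spanned_submod P.
have span_hpart d v : D v -> spanned P (hpart d v).
  elim/ltn_ind: d v => d IHd _ /genD[w [L [p [u [[c ->] Du p0 ->]]]]].
  rewrite raddfD !raddf_sum.
  apply: submodD => //; apply: submod_sum => // l _ /=.
    apply: spanned_hpart_scale => m _ _; rewrite -homP hpart_hpart.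
    by case: eqP => _; [rewrite homP; apply: spanned_mem | case: submP].
  apply: spanned_hpart_scale => m m_p le_md; apply: IHd (Du l).
  have m_gt0 : (0 < mdeg m)%N.
    rewrite lt0n mdeg_eq0; apply: contraTneq m_p => ->.
    by rewrite mcoeff_msupp p0 eqxx.
  by rewrite ltn_subrL m_gt0 (leq_trans m_gt0).
move=> v Dv; have [N /(_ tt)->] := hpart_partition (fun _ : unit => v).
by apply: submod_sum => // d _; apply: span_hpart.
Qed.

End GradedModules.

Lemma row_inj_of_row_free_map (S : idomainType) (K : fieldType)
    (ev : {rmorphism S -> K}) r m (Q : 'M[S]_(r, m)) (R : 'M[S]_(m, r))
    (a : 'rV_r) :
  Q *m R *m Q = Q -> row_free (map_mx ev Q) -> a *m Q = 0 -> a = 0.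
Proof.
move=> QRQ freeQ aQ0.
have evQR : map_mx ev (Q *m R) = 1%:M.
  by apply: (row_free_inj freeQ); rewrite mul1mx -map_mxM QRQ.
apply: contraTeq isT => a_neq0.
have: \det (Q *m R) == 0 by apply/det0P; exists a; rewrite // mulmxA aQ0 mul0mx.
move/eqP/(congr1 ev); rewrite -det_map_mx evQR det1 rmorph0 => /eqP.
by rewrite oner_eq0.
Qed.

Section GradedSummand.
Variables (K : fieldType) (n : nat) (J : finType).
Local Notation S := {mpoly K[n]}.
Local Notation V := {ffun J -> S^o}.
Local Notation ev0 := (mcoeff 0%MM : {rmorphism S -> K}).
Variables (D : V -> Prop) (m : nat) (B : 'I_m -> V) (E : 'M[S]_m).
Hypotheses (gradD : is_graded D) (freeB : lin_indep B) (E_idem : E *m E = E).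
Hypothesis D_summand : forall v, D v <-> in_summand B E v.

Lemma summand_row_mem i : D (rowcomb B (row i E)).
Proof. by apply/D_summand; exists (row i E); rewrite // -row_mul E_idem. Qed.

Lemma homogeneous_coords :
  exists q (C : 'M[S]_(q, m)) (deg : 'I_q -> nat),
    [/\ C *m E = C,
        forall i, hpart (deg i) (rowcomb B (row i C)) = rowcomb B (row i C)
      & (map_mx ev0 E <= map_mx ev0 C)%MS].
Proof.
have [N row_parts] := hpart_partition (fun i => rowcomb B (row i E)).
have /fin_all_exists2[c cE c_coord] (x : 'I_m * 'I_N) :
    in_summand B E (hpart x.2 (rowcomb B (row x.1 E))).
  exact/D_summand/gradD/summand_row_mem.
pose C : 'M[S]_(#|{: 'I_m * 'I_N}|, m) := \matrix_q c (enum_val q).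
exists _, C, (fun q => nat_of_ord (enum_val q).2).
split=> [|q|].
- by apply/row_matrixP => q; rewrite row_mul !rowK.
- by rewrite rowK -c_coord hpart_hpart eqxx.
- apply/row_subP => i; rewrite -map_row.
  have -> : map_mx ev0 (row i E) =
      \sum_d row (enum_rank (i, d)) (map_mx ev0 C).
    have -> : row i E = \sum_d c (i, d).
      apply: (rowcomb_inj freeB); rewrite raddf_sum row_parts /=.
      by apply: eq_bigr => d _; apply: (c_coord (i, d)).
    rewrite raddf_sum.
    by apply: eq_bigr => d _; rewrite -map_row rowK enum_rankK.
  by apply: summx_sub => d _; apply: row_sub.
Qed.

Section HomogeneousRows.
Variables (r : nat) (Q : 'M[S]_(r, m)) (deg : 'I_r -> nat).
Local Notation P := (fun i => rowcomb B (row i Q)).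
Hypotheses (QE : Q *m E = Q) (homQ : forall i, hpart (deg i) (P i) = P i).
Hypothesis freeQ0 : row_free (map_mx ev0 Q).
Hypothesis fullQ0 : (map_mx ev0 E <= map_mx ev0 Q)%MS.

Lemma homogeneous_rows_span v : D v -> spanned P v.
Proof.
move: v; apply: (graded_nakayama gradD homQ) => _ /D_summand[a aE ->].
have /submxP[b a0E] : (map_mx ev0 a <= map_mx ev0 Q)%MS.
  by rewrite -aE map_mxM mulmx_sub.
pose c := map_mx (@mpolyC n K) b; pose p := a - c *m Q.
exists (rowcomb B (c *m Q)), 'I_m, (p 0), (fun i => rowcomb B (row i E)).
split=> [|i|i|].
- by exists (c 0); rewrite rowcomb_mulmx.
- exact: summand_row_mem.
- have /rowP/(_ i) : map_mx ev0 p = 0.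
    rewrite map_mxB map_mxM a0E (_ : map_mx ev0 c = b) ?subrr //.
    by apply/matrixP => k l; rewrite !mxE /= mcoeffC eqxx mulr1.
  by rewrite !mxE.
- have -> : a = c *m Q + p *m E.
    by rewrite mulmxBl -mulmxA QE aE addrC subrK.
  by rewrite raddfD /= [in X in _ + X]rowcomb_mulmx.
Qed.

Lemma homogeneous_rows_basis : is_basis D P.
Proof.
split=> [i||c c_rel i].
- by apply/D_summand; exists (row i Q); rewrite // -row_mul QE.
- exact: homogeneous_rows_span.
- have /fin_all_exists[R E_coord] j : exists a : 'rV_r, row j E = a *m Q.
    have [a aE] := homogeneous_rows_span (summand_row_mem j).
    exists (\row_k a k); apply: (rowcomb_inj freeB); rewrite aE rowcomb_mulmx.
    by apply: eq_bigr => k _; rewrite mxE.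
  have ERQ : E = (\matrix_j R j) *m Q.
    by apply/row_matrixP => j; rewrite row_mul rowK.
  suff /rowP/(_ i) : \row_i c i = 0 by rewrite !mxE.
  apply: (row_inj_of_row_free_map (R := \matrix_j R j)) freeQ0 _.
    by rewrite -mulmxA -ERQ.
  apply: (rowcomb_inj freeB); rewrite rowcomb_mulmx linear0 -[RHS]c_rel.
  by apply: eq_bigr => j _; rewrite mxE.
Qed.

End HomogeneousRows.

Lemma graded_summand_free : exists r (P : 'I_r -> V), is_basis D P.
Proof.
have [q [C [deg [CE homC fullC]]]] := homogeneous_coords.
pose f := maxrankfun (map_mx ev0 C).
have mapQ : map_mx ev0 (rowsub f C) = rowsub f (map_mx ev0 C).
  exact: map_mxsub.
exists _, (fun i => rowcomb B (row i (rowsub f C))).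
apply: (homogeneous_rows_basis (deg := deg \o f)) => [|i||].
- by apply/row_matrixP => i; rewrite row_mul !row_rowsub -row_mul CE.
- by rewrite row_rowsub /= homC.
- by rewrite mapQ maxrowsub_free.
- by rewrite mapQ eq_maxrowsub.
Qed.

End GradedSummand.

Definition lin_cong (R : comNzRingType) (J : finType) (X : eqType) (A : seq X)
    (a : X -> J -> R) (l : X -> R) (v : {ffun J -> R^o}) : Prop :=
  forall H, H \in A -> exists g, \sum_j a H j * v j = l H * g.

Lemma lin_cong_submod (R : comNzRingType) (J : finType) (X : eqType) (A : seq X)
    (a : X -> J -> R) (l : X -> R) : is_submod (lin_cong A a l).
Proof.
split=> [H _|b u v Du Dv H HA].
  by exists 0; rewrite mulr0 big1 // => j _; rewrite ffunE mulr0.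
have [g ug] := Du H HA; have [h vh] := Dv H HA.
exists (b * g + h); rewrite mulrDr mulrCA -ug -vh mulr_sumr -big_split.
by apply: eq_bigr => j _; rewrite !ffunE mulrDr mulrCA.
Qed.

Lemma lin_cong_graded (R : comNzRingType) n (J : finType) (X : eqType)
    (A : seq X) (a : X -> J -> R) (l : X -> {mpoly R[n]}) (deg : X -> nat) :
  (forall H, l H \is (deg H).-homog) ->
  is_graded (lin_cong A (fun H j => (a H j)%:MP) l).
Proof.
move=> homl d v Dv H HA; have [g vg] := Dv H HA.
exists (if (deg H <= d)%N then pihomog mdeg (d - deg H) g else 0).
rewrite (fun_if ( *%R (l H))) mulr0 -pihomogMl // -vg raddf_sum.
by apply: eq_bigr => j _ /=; rewrite hpartE !mul_mpolyC linearZ /=.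
Qed.

(* The hypotheses make [R'] a direct summand of the free [R]-module
   [R[X_1..X_N]], hence flat over [R]. *)
Section BaseChange.
Variables (R R' : comNzRingType) (f : {rmorphism R -> R'}) (N : nat).
Variables (e : 'I_N -> R') (split : {additive R' -> {mpoly R[N]}}).
Hypothesis splitZ : forall a x, split (f a * x) = a *: split x.
Hypothesis splitK : forall x, mmap f e (split x) = x.

Definition map_vec (J : finType) (v : {ffun J -> R^o}) : {ffun J -> R'^o} :=
  [ffun j => f (v j)].

Lemma map_vec_sum (J I : finType) (c : I -> R) (v : I -> {ffun J -> R^o}) :
  map_vec (\sum_i c i *: v i) = \sum_i f (c i) *: map_vec (v i).
Proof.
apply/ffunP => j; rewrite ffunE !sum_ffunE rmorph_sum.
by apply: eq_bigr => i _; rewrite !ffunE rmorphM.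
Qed.

Definition coef_vec (J : finType) (v : {ffun J -> R'^o}) m : {ffun J -> R^o} :=
  [ffun j => (split (v j))@_m].

Lemma vec_expand (J : finType) (v : {ffun J -> R'^o}) :
  exists M, v = \sum_(m : 'X_{1..N < M}) mmap1 e m *: map_vec (coef_vec v m).
Proof.
exists (\max_j msize (split (v j)))%N; apply/ffunP => j; rewrite sum_ffunE.
rewrite -[LHS]splitK (mmapE (\max_j msize (split (v j)))%N); last first.
  exact: (leq_bigmax (F := fun j => msize (split (v j)))).
by apply: eq_bigr => m _; rewrite !ffunE mulrC.
Qed.

Lemma is_basis_base_change (J : finType) (X : eqType) (A : seq X)
    (a : X -> J -> R) (l : X -> R) (L : finType) (B : L -> {ffun J -> R^o}) :
  is_basis (lin_cong A a l) B ->
  is_basis (lin_cong A (fun H j => f (a H j)) (fun H => f (l H)))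
    (@map_vec J \o B).
Proof.
move=> [DB spanB freeB]; split=> [i H HA|v Dv|c c_rel i] /=.
- have [g Bg] := DB i H HA; exists (f g); rewrite -rmorphM -Bg rmorph_sum.
  by apply: eq_bigr => j _; rewrite ffunE -rmorphM.
- have [M ->] := vec_expand v; have submB := spanned_submod (@map_vec J \o B).
  apply: submod_sum => // m _; apply: submodZ => //.
  have [|c ->] := spanB (coef_vec v m); last first.
    by exists (f \o c); rewrite map_vec_sum.
  move=> H HA; have [g vg] := Dv H HA; exists (split g)@_m.
  rewrite -mcoeffZ -splitZ -vg !raddf_sum; apply: eq_bigr => j _ /=.
  by rewrite ffunE splitZ mcoeffZ.
- rewrite -[c i]splitK [split (c i)](_ : _ = 0) ?mmap0 //.
  apply/mpolyP => m; rewrite mcoeff0.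
  apply: (freeB (fun i => (split (c i))@_m)); apply/ffunP => j.
  have /ffunP/(_ j)/(congr1 split)/(congr1 (mcoeff m)) := c_rel.
  rewrite !sum_ffunE !ffunE raddf_sum raddf0 mcoeff0 raddf_sum /= => coef_rel.
  rewrite -[RHS]coef_rel; apply: eq_bigr => k _.
  by rewrite !ffunE /= [c k *: _]mulrC splitZ mcoeffZ [LHS]mulrC.
Qed.

End BaseChange.

Lemma eq_mpoly_rmorph (R S : nzRingType) n
    (f g : {rmorphism {mpoly R[n]} -> S}) :
  (forall c, f c%:MP = g c%:MP) -> (forall i, f 'X_i = g 'X_i) -> f =1 g.
Proof.
move=> fgC fgX p; rewrite [p]mpolyE !rmorph_sum; apply: eq_bigr => m _.
rewrite -mul_mpolyC !rmorphM /= fgC; congr (_ * _).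
rewrite mpolyXE_id !rmorph_prod; apply: eq_bigr => i _.
by rewrite !rmorphXn /= fgX.
Qed.

Section Rename.
Variables (R : comNzRingType) (n N : nat) (s : 'I_n -> 'I_N).

Definition mrename : {mpoly R[n]} -> {mpoly R[N]} :=
  comp_mpoly [tuple 'X_(s i) | i < n].

HB.instance Definition _ := GRing.RMorphism.on mrename.

Lemma mrenameC c : mrename c%:MP = c%:MP.
Proof. exact: comp_mpolyC. Qed.

Lemma mrenameX i : mrename 'X_i = 'X_(s i).
Proof. by rewrite /mrename comp_mpolyXU -tnth_nth tnth_mktuple. Qed.

(* [msplit] regards a polynomial as one in the variables outside the image of
   [s], with coefficients in the polynomial ring on the others. *)
Definition msplit_var (k : 'I_N) : {mpoly {mpoly R[n]}[N]} :=
  if [pick i | s i == k] is Some i then ('X_i)%:MP else 'X_k.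

Definition msplit : {mpoly R[N]} -> {mpoly {mpoly R[n]}[N]} :=
  mmap (@mpolyC N {mpoly R[n]} \o @mpolyC n R) msplit_var.

HB.instance Definition _ := GRing.RMorphism.on msplit.

Lemma msplitK p : mmap mrename (fun k => 'X_k) (msplit p) = p.
Proof.
apply: (eq_mpoly_rmorph (f := mmap mrename (fun k => 'X_k) \o msplit)
  (g := idfun)) => [c|k] /=.
  by rewrite /msplit !mmapC /= mrenameC.
rewrite /msplit mmapX mmap1U /msplit_var; case: pickP => [i /eqP <-|_].
  by rewrite mmapC /= mrenameX.
by rewrite mmapX mmap1U.
Qed.

Hypothesis s_inj : injective s.

Lemma msplit_rename p : msplit (mrename p) = p%:MP.
Proof.
apply: (eq_mpoly_rmorph (f := msplit \o mrename) (g := @mpolyC N {mpoly R[n]}))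
  => [c|i] /=.
  by rewrite mrenameC /msplit mmapC.
rewrite mrenameX /msplit mmapX mmap1U /msplit_var.
by case: pickP => [j /eqP/s_inj-> //|/(_ i)]; rewrite eqxx.
Qed.

Lemma msplit_renameM p q : msplit (mrename p * q) = p *: msplit q.
Proof. by rewrite rmorphM /= msplit_rename mul_mpolyC. Qed.

End Rename.

Section LogarithmicDerivations.
Variables (K : fieldType) (T : finType).
Implicit Types (a : {ffun T -> K}) (A : centralArr K T).

Lemma coordX_neq0 (j : T) : coordX K j != 0.
Proof.
apply/eqP => /(congr1 (mcoeff U_(enum_rank j)%MM)).
by rewrite mcoeffX eqxx mcoeff0 => /eqP; rewrite oner_eq0.
Qed.

Lemma linpoly_homog a : linpoly a \is 1.-homog.
Proof. by apply: rpred_sum => j _; rewrite rpredZ // dhomogX /= mdeg1. Qed.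

Lemma der_apply_linpoly (theta : der K T) a :
  der_apply theta (linpoly a) = \sum_j (a j)%:MP * theta j.
Proof.
apply: eq_bigr => j _; rewrite raddf_sum (bigD1 j) //= big1 => [|i ne_ij].
  rewrite mderivZ mderivX mnm1E eqxx scale1r addr0 -{1}[U_(_)%MM]add0m addmK.
  by rewrite mpolyX0 -mul_mpolyC mulr1 mulrC.
rewrite mderivZ mderivX mnm1E (inj_eq enum_rank_inj) (negbTE ne_ij).
by rewrite scale0r scaler0.
Qed.

Definition log_module A : {ffun T -> (polyring K T)^o} -> Prop :=
  lin_cong A (fun a j => (a j)%:MP) (@linpoly K T).

Lemma logderE A (theta : der K T) : logder A theta <-> log_module A theta.
Proof.
by split=> Dtheta a /Dtheta[g]; rewrite ?der_apply_linpoly => theta_a; exists g;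
  rewrite ?der_apply_linpoly.
Qed.

Definition euler : {ffun T -> (polyring K T)^o} := [ffun j => coordX K j].

Lemma log_module_euler A : log_module A euler.
Proof.
move=> a _; exists 1; rewrite mulr1; apply: eq_bigr => j _.
by rewrite ffunE mul_mpolyC.
Qed.

Lemma free_arrP A :
  free_arr A <-> exists m (B : 'I_m -> {ffun T -> (polyring K T)^o}),
    is_basis (log_module A) B.
Proof.
split=> -[m [B [DB spanB freeB]]]; exists m, B; split=> //.
- by move=> i; apply/logderE.
- by move=> v /logderE/spanB.
- by move=> i; apply/logderE.
- by move=> v /logderE/spanB.
Qed.

Lemma basis_free_arr A (L : finType) (B : L -> {ffun T -> (polyring K T)^o}) :
  is_basis (log_module A) B -> free_arr A.
Proof.
move=> basisB; apply/free_arrP; exists #|L|, (B \o enum_val).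
exact/is_basis_reindex/basisB/enum_val_bij.
Qed.

End LogarithmicDerivations.

Section Cone.
Variables (K : fieldType) (T : finType).
Local Notation S := (polyring K (option T)).
Implicit Type A : affArr K T.

Lemma linpoly_x0Form : linpoly (x0Form K T) = coordX K None.
Proof.
rewrite /linpoly big_option /= ffunE scale1r big1 ?addr0 // => t _.
by rewrite ffunE scale0r.
Qed.

Lemma euler_None_neq0 : vec_eval None (euler K (option T)) != 0.
Proof. by rewrite /vec_eval ffunE coordX_neq0. Qed.

Lemma log_module_None_dvd A v :
  log_module (cone A) v ->
  exists g, vec_eval None v = g * vec_eval None (euler K (option T)).
Proof.
move=> /(_ (x0Form K T)); rewrite inE eqxx linpoly_x0Form => /(_ isT)[g].
rewrite big_option /= ffunE mul1r big1 ?addr0 => [x0_v|t _]; last first.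
  by rewrite ffunE mul0r.
by exists g; rewrite /vec_eval ffunE mulrC.
Qed.

Definition log_module0 A : {ffun option T -> S^o} -> Prop :=
  in_kernel (log_module (cone A)) (vec_eval None).

(* An element of [log_module0 A], given by its coefficients outside [x_0]. *)
Definition affine_log_module A : {ffun T -> S^o} -> Prop :=
  lin_cong A (fun H t => (ah_form H t)%:MP) (fun H => linpoly (coneForm H)).

Lemma affine_log_moduleE A v :
  affine_log_module A v <-> log_module0 A (extend_none v).
Proof.
have sum_coneForm (H : affHyp K T) :
    \sum_j (coneForm H j)%:MP * extend_none v j =
    \sum_t (ah_form H t)%:MP * v t.
  rewrite big_option /= [extend_none v None]ffunE mulr0 add0r.
  by apply: eq_bigr => t _; rewrite !ffunE.
split=> [Dv|[Dv _] H HA]; last first.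
  have [|g vg] := Dv (coneForm H); first by rewrite inE map_f ?orbT.
  by exists g; rewrite -vg sum_coneForm.
split=> [a|]; last exact: ffunE.
rewrite inE => /orP[/eqP->|/mapP[H HA ->]].
  exists 0; rewrite mulr0 big1 // => -[t|] _; rewrite !ffunE ?mulr0 //.
  by rewrite mul0r.
by have [g vg] := Dv H HA; exists g; rewrite sum_coneForm.
Qed.

Lemma log_module0_restr A v :
  log_module0 A v ->
  affine_log_module A (restr_some v) /\ extend_none (restr_some v) = v.
Proof.
move=> D0v; have vK : extend_none (restr_some v) = v.
  by apply: restr_someK; case: D0v.
by split=> //; apply/affine_log_moduleE; rewrite vK.
Qed.

Lemma affine_log_module_extend A v :
  affine_log_module A v ->
  log_module0 A (extend_none v) /\ restr_some (extend_none v) = v.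
Proof. by move=> /affine_log_moduleE Dv; split=> //; apply: extend_noneK. Qed.

Lemma log_module0_graded A : is_graded (log_module0 A).
Proof.
move=> d v [Dv v0]; split; last first.
  rewrite -(raddf0 (pihomog mdeg d)) -v0; exact: hpartE.
by apply: (lin_cong_graded (deg := fun=> 1%N)) Dv => a; apply: linpoly_homog.
Qed.

Lemma log_module0_free A : free_arr (cone A) ->
  exists m (B : 'I_m -> {ffun option T -> S^o}), is_basis (log_module0 A) B.
Proof.
move=> /free_arrP[m [B basisB]]; have [_ _ freeB] := basisB.
have [E [E_idem summandE]] := in_kernel_summand (lin_cong_submod _ _ _)
  (@log_module_euler _ _ (cone A)) euler_None_neq0 (@log_module_None_dvd A)
  basisB.
exact: graded_summand_free (@log_module0_graded A) freeB E_idem summandE.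
Qed.

Lemma affine_log_module_free A : free_arr (cone A) ->
  exists m (B : 'I_m -> {ffun T -> S^o}), is_basis (affine_log_module A) B.
Proof.
move=> /log_module0_free[m [B basisB]]; exists m, (@restr_some _ _ \o B).
exact: is_basis_transfer (@log_module0_restr A)
  (@affine_log_module_extend A) basisB.
Qed.

Lemma free_cone_of_basis A (L : finType) (B : L -> {ffun T -> S^o}) :
  is_basis (affine_log_module A) B -> free_arr (cone A).
Proof.
move=> basisB.
have basis0 := is_basis_transfer (@affine_log_module_extend A)
  (@log_module0_restr A) basisB.
apply: basis_free_arr; apply: is_basis_split_off basis0.
- exact: lin_cong_submod.
- exact: log_module_euler.
- exact: euler_None_neq0.
- exact: log_module_None_dvd.
Qed.

End Cone.

Section ConeDirectSum.
Variables (K : fieldType) (I : finType) (T : I -> finType).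
Variable A : forall i, affArr K (T i).

Lemma liftFormE i (a : {ffun T i -> K}) (p : {i : I & T i}) :
  liftForm a p = untag 0 a p.
Proof.
rewrite /liftForm; case: eqVneq => [e|ne]; first by rewrite (untagE _ _ e).
by rewrite untag_dflt.
Qed.

Lemma sum_liftHyp (W : nmodType) i (H : affHyp K (T i))
    (F : K -> {i : I & T i} -> W) :
  (forall p, F 0 p = 0) ->
  \sum_p F (ah_form (liftHyp H) p) p = \sum_t F (ah_form H t) (Tagged T t).
Proof.
move=> F0; rewrite (big_tagged_supp _ (i := i)) => [|p ne_pi].
  by apply: eq_bigr => t _; rewrite ffunE liftFormE untag_Tagged.
by rewrite ffunE liftFormE untag_dflt ?F0.
Qed.

Definition cone_var i (k : 'I_#|{: option (T i)}|) :
    'I_#|{: option {i : I & T i}}| :=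
  enum_rank (omap (Tagged T) (enum_val k)).

Lemma cone_var_inj i : injective (@cone_var i).
Proof.
move=> k l /enum_rank_inj kl; apply: enum_val_inj.
case: (enum_val k) (enum_val l) kl => [x|] [y|] //= [] /eqP.
by rewrite eq_Tagged /= => /eqP ->.
Qed.

Lemma mrename_coordX i (j : option (T i)) :
  mrename (@cone_var i) (coordX K j) = coordX K (omap (Tagged T) j).
Proof. by rewrite mrenameX /cone_var enum_rankK. Qed.

Lemma mrename_coneForm i (H : affHyp K (T i)) :
  mrename (@cone_var i) (linpoly (coneForm H)) = linpoly (coneForm (liftHyp H)).
Proof.
rewrite /linpoly rmorph_sum !big_option /=.
have mrename_term c j : mrename (@cone_var i) (c *: coordX K j) =
    c *: coordX K (omap (Tagged T) j).
  by rewrite -mul_mpolyC rmorphM /= mrenameC mrename_coordX mul_mpolyC.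
rewrite mrename_term !ffunE; congr (_ + _).
under eq_bigr do rewrite mrename_term ffunE.
under [RHS]eq_bigr do rewrite ffunE.
rewrite (sum_liftHyp _ (F := fun c p => c *: coordX K (Some p))) // => p.
by rewrite scale0r.
Qed.

Lemma affine_log_module_dirsum v :
  (forall i, lin_cong (A i)
     (fun H t => mrename (@cone_var i) (ah_form H t)%:MP)
     (fun H => mrename (@cone_var i) (linpoly (coneForm H))) (block_proj i v))
  <-> affine_log_module (dirsum A) v.
Proof.
have sum_lift i (H : affHyp K (T i)) :
    \sum_p (ah_form (liftHyp H) p)%:MP * v p =
    \sum_t mrename (@cone_var i) (ah_form H t)%:MP * block_proj i v t.
  rewrite (sum_liftHyp _ (F := fun c p => c%:MP * v p)) => [|p]; last first.
    by rewrite mpolyC0 mul0r.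
  by apply: eq_bigr => t _; rewrite mrenameC ffunE.
split=> [Dv _ /flatten_mapP[i _ /mapP[H HA ->]]|Dv i H HA].
  by have [g vg] := Dv i H HA; exists g; rewrite sum_lift vg mrename_coneForm.
have [|g vg] := Dv (liftHyp H).
  by apply/flatten_mapP; exists i; rewrite ?mem_enum ?map_f.
by exists g; rewrite -sum_lift vg mrename_coneForm.
Qed.

Lemma free_cone_dirsum :
  (forall i, free_arr (cone (A i))) -> free_arr (cone (dirsum A)).
Proof.
move=> freeA.
have /fin_all_exists[m /fin_all_exists[B basisB]] i :=
  affine_log_module_free (freeA i).
have basis_ext i := is_basis_base_change (msplit_renameM (@cone_var_inj i))
  (@msplitK K _ _ (@cone_var i)) (basisB i).
have := is_basis_biproduct (@block_injK _ _ _) (@block_proj_inj0 _ _ _)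
  (@block_sum _ _ _) (fun i => proj1 (lin_cong_submod _ _ _)) basis_ext.
by move/(eq_is_basis affine_log_module_dirsum)/free_cone_of_basis.
Qed.

End ConeDirectSum.

Theorem mainTheorem10 (K : fieldType) (k : nat) (n : 'I_k -> nat)
  (A : forall i : 'I_k, affArr K 'I_(n i)) :
  (forall i, wf_affArr (A i)) ->
  (forall i, free_arr (cone (A i))) ->
  free_arr (cone (dirsum A)).
Proof. by move=> _; apply: free_cone_dirsum. Qed.
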